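(* Let $a,b>0$, let $n\in\mathbb{N}$ with $n\ge 2$, and let $v\in\mathbb{R}$ with $v\neq\frac12$. (i) If $v\notin\left[\frac12,\frac{2^{n-1}+1}{2^n}\right]$, then $$(1-v)a+vb\le a^{1-v}b^v+(1-v)\left(\sqrt a-\sqrt b\right)^2+(2v-1)\sqrt{ab}\sum_{k=2}^n 2^{k-2}\left(\sqrt[2^k]{\frac{b}{a}}-1\right)^2.$$ (ii) If $v\notin\left[\frac{2^{n-1}-1}{2^n},\frac12\right]$, then $$(1-v)a+vb\le a^{1-v}b^v+v\left(\sqrt a-\sqrt b\right)^2+(1-2v)\sqrt{ab}\sum_{k=2}^n 2^{k-2}\left(\sqrt[2^k]{\frac{a}{b}}-1\right)^2.$$
   Context: All powers and roots are the usual real powers and roots of positive real numbers; $\sqrt[m]{x}=x^{1/m}$. *)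

(* Defs.v *)
From mathcomp Require Import all_boot all_order all_algebra.
From mathcomp Require Import all_classical all_reals all_analysis.

Set Implicit Arguments.
Unset Strict Implicit.
Unset Printing Implicit Defensive.

(* Main.v *)
Require Import Defs.
From mathcomp Require Import all_boot all_order all_algebra.
From mathcomp Require Import all_classical all_reals all_analysis.
From mathcomp Require Import ring lra.
Import Order.TTheory GRing.Theory Num.Theory.
Local Open Scope ring_scope.

(** The weights $2^{k-2}$ make the sum telescope: writing $x = b/a$ and
    $s_k = x^{1/2^k}$, the relation $s_{k-1} = s_k^2$ gives
    $2^{k-2} (s_k - 1)^2 = 2^{k-2} (s_{k-1} - 1) - 2^{k-1} (s_k - 1)$,
    so the sum is $(s_1 - 1) - 2^{n-1} (s_n - 1)$ ([sum_dyadic_roots]).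
    Since $s_1 = \sqrt b / \sqrt a$, everything polynomial in $\sqrt a$ and
    $\sqrt b$ then cancels except one multiple of $\sqrt{ab}$, and the
    factorization $a^{1-v} b^v = \sqrt{ab}\, x^{v - 1/2}$ turns (i) into
    $$1 + r (y - 1) \le y^r, \qquad y = s_n,\quad r = 2^n (v - 1/2).$$
    This is the Bernoulli inequality ([powR_bernoulli]), valid for $y > 0$
    whenever $r \le 0$ or $r \ge 1$, and $v \notin [1/2, (2^{n-1}+1)/2^n]$ means
    exactly $r \notin [0, 1]$.  Statement (ii) is (i) with $a$ and $b$
    exchanged and $v$ replaced by $1 - v$. *)

(** Jensen's inequality for the exponential at barycentre $0$, with weights
    that are not normalized: both tangent bounds $1 + z \le e^z$ are taken at
    $0$, and their linear parts cancel. *)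
Lemma expR_weighted_mean (R : realType) (p q s t : R) : 0 <= p -> 0 <= q ->
  p * s + q * t = 0 -> p + q <= p * expR s + q * expR t.
Proof.
move=> p0 q0 bary.
have hs := ler_wpM2l p0 (expR_ge1Dx s).
have ht := ler_wpM2l q0 (expR_ge1Dx t).
lra.
Qed.

(** With $y = e^t$, this is convexity of the exponential along the three points
    $0$, $t$, $rt$: the middle one is $0$ when $r \le 0$ and $t$ when
    $r \ge 1$. *)
Lemma powR_bernoulli (R : realType) (y r : R) :
  0 < y -> r <= 0 \/ 1 <= r -> 1 + r * (y - 1) <= y `^ r.
Proof.
move=> y0 hr; rewrite -(lnK y0) -expRM mulrC; set t := ln y.
case: hr => hr.
  have nr : 0 <= - r by lra.
  have := @expR_weighted_mean R 1 (- r) (r * t) t ler01 nr ltac:(ring).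
  by rewrite (mulrC t); lra.
have r1 : 0 <= r - 1 by lra.
(* The barycentre is $t$, so the points are translated by $-t$ and the
   resulting inequality is scaled back by $e^t$. *)
have := @expR_weighted_mean R 1 (r - 1) (r * t - t) (- t) ler01 r1 ltac:(ring).
move/(ler_wpM2r (expR_ge0 t)).
rewrite [leRHS]mulrDl -!mulrA -!expRD subrK addNr expR0 (mulrC t).
by lra.
Qed.

Lemma sum_dyadic_roots (R : realType) (x : R) (m : nat) :
  \sum_(2 <= k < m.+2) 2 ^+ (k - 2) * (x `^ (1 / 2 ^+ k) - 1) ^+ 2 =
  (x `^ (1 / 2) - 1) - 2 ^+ m * (x `^ (1 / 2 ^+ m.+1) - 1).
Proof.
elim: m => [|m IHm]; first by rewrite big_geq// expr0 expr1; ring.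
rewrite big_nat_recr //= IHm subSS subSS subn0.
have -> : x `^ (1 / 2 ^+ m.+1) = x `^ (1 / 2 ^+ m.+2) ^+ 2.
  rewrite -powR_mulrn ?powR_ge0// -powRrM; congr (_ `^ _).
  by rewrite (exprS _ m.+1); field; rewrite expf_neq0.
by rewrite (exprS _ m); ring.
Qed.

Lemma weighted_geometric_meanE (R : realType) (a b v : R) : 0 < a -> 0 < b ->
  a `^ (1 - v) * b `^ v = Num.sqrt a * Num.sqrt b * (b / a) `^ (v - 1 / 2).
Proof.
move=> a0 b0; rewrite -!powR12_sqrt ?ltW//.
rewrite -(lnK a0) -(lnK b0) -expRN -expRD -!expRM -!expRD.
by congr expR; field.
Qed.

(** For $r = 2^{m+1} (v - 1/2) = 2^m (2v - 1)$ the two alternatives say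
    $r \le 0$ and $r \ge 1$. *)
Lemma young_dyadic_le (R : realType) (a b v : R) (m : nat) : 0 < a -> 0 < b ->
  v <= 1 / 2 \/ (2 ^+ m + 1) / 2 ^+ m.+1 <= v ->
  (1 - v) * a + v * b <=
    a `^ (1 - v) * b `^ v + (1 - v) * (Num.sqrt a - Num.sqrt b) ^+ 2
    + (2 * v - 1) * Num.sqrt (a * b) *
      \sum_(2 <= k < m.+2)
        2 ^+ (k - 2) * ((b / a) `^ (1 / 2 ^+ k) - 1) ^+ 2.
Proof.
move=> a0 b0 hv.
have x0 : 0 < b / a by rewrite divr_gt0.
have p0 : 0 < 2 ^+ m :> R by rewrite exprn_gt0.
have sa0 : 0 < Num.sqrt a by rewrite sqrtr_gt0.
have sb0 : 0 < Num.sqrt b by rewrite sqrtr_gt0.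
rewrite sum_dyadic_roots weighted_geometric_meanE// (sqrtrM _ (ltW a0)).
have -> : (b / a) `^ (1 / 2) = Num.sqrt b / Num.sqrt a.
  by rewrite mul1r powR12_sqrt ?ltW// sqrtrM ?ltW// sqrtrV ?ltW.
have -> : v - 1 / 2 = 1 / 2 ^+ m.+1 * (2 ^+ m * (2 * v - 1)).
  by rewrite exprS; field; rewrite gt_eqF.
rewrite powRrM; set y := (b / a) `^ (1 / 2 ^+ m.+1).
have hr : 2 ^+ m * (2 * v - 1) <= 0 \/ 1 <= 2 ^+ m * (2 * v - 1).
  case: hv => hv; [left|right]; first by rewrite pmulr_rle0//; lra.
  by move: hv; rewrite ler_pdivrMr ?exprn_gt0// exprS; lra.
have hB := ler_wpM2l (ltW (mulr_gt0 sa0 sb0))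
  (powR_bernoulli _ y _ (powR_gt0 _ x0) hr).
rewrite -{1}(sqr_sqrtr (ltW a0)) -{1}(sqr_sqrtr (ltW b0)).
rewrite -subr_ge0; move: hB; rewrite -subr_ge0; congr (_ <= _).
by field; rewrite gt_eqF.
Qed.

Theorem theorem1 (R : realType) (a b : R) (ha : 0 < a) (hb : 0 < b)
    (n : nat) (hn : (2 <= n)%N) (v : R) (hv : v <> 1 / 2) :
  (v \notin `[1 / 2, (2 ^+ (n - 1) + 1) / 2 ^+ n] ->
    (1 - v) * a + v * b <=
      a `^ (1 - v) * b `^ v + (1 - v) * (Num.sqrt a - Num.sqrt b) ^+ 2
      + (2 * v - 1) * Num.sqrt (a * b) *
        \sum_(2 <= k < n.+1)
          2 ^+ (k - 2) * ((b / a) `^ (1 / 2 ^+ k) - 1) ^+ 2)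
  /\
  (v \notin `[(2 ^+ (n - 1) - 1) / 2 ^+ n, 1 / 2] ->
    (1 - v) * a + v * b <=
      a `^ (1 - v) * b `^ v + v * (Num.sqrt a - Num.sqrt b) ^+ 2
      + (1 - 2 * v) * Num.sqrt (a * b) *
        \sum_(2 <= k < n.+1)
          2 ^+ (k - 2) * ((a / b) `^ (1 / 2 ^+ k) - 1) ^+ 2).
Proof.
case: n hn => // m _; rewrite subn1 /=.
have p0 : 0 < 2 ^+ m :> R by rewrite exprn_gt0.
split; rewrite in_itv/= negb_and -!ltNge => /orP hI.
  by apply: young_dyadic_le => //; case: hI => /ltW; [left|right].
have := @young_dyadic_le R b a (1 - v) m hb ha.
have -> : 1 - (1 - v) = v by ring.
have -> : 2 * (1 - v) - 1 = 1 - 2 * v by ring.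
rewrite (addrC (v * b)) (mulrC (b `^ v)) (mulrC b a) -(sqrrN (Num.sqrt b - _)) opprB.
apply; case: hI => hI; [right|left; lra].
have -> : (2 ^+ m + 1) / 2 ^+ m.+1 = 1 - (2 ^+ m - 1) / 2 ^+ m.+1 :> R.
  by rewrite exprS; field; rewrite gt_eqF.
by rewrite lerD2l lerN2 ltW.
Qed.
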